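(* There exist constants $C>0$, $\alpha>0$ depending only on $\lambda$ such that the following holds. Let $(\rho,u,f_H)$ be an optimal triple on $[0,T]$ for the pressure-less Euler control problem with initial data $(\rho_0,u_0)=(\rho,u)(0)$, and assume that for every $a\in[0,T)$ there exists an admissible triple $(\tilde\rho,\tilde u,\tilde f_H)$ on $[a,T]$ with $\tilde\rho(a)=\rho(a)$, $\tilde u(a)=u(a)$ and $\tilde f_H=-\lambda^{-1/2}(\tilde u-\bar v)$. Then $$\int_{\mathbb R^D}\rho(t,x)|u(t,x)-\bar v|^2dx\le Ce^{-\alpha t}\int_{\mathbb R^D}\rho_0(x)|u_0(x)-\bar v|^2dx\qquad\text{for all }t\in(0,T).$$
   Context: Fix $D\ge1$, $T>0$, $\lambda>0$, $\bar v\in\mathbb R^D$, and an interaction kernel $\Psi:\mathbb R^D\times\mathbb R^D\to\mathbb R$ which is Lipschitz continuous, symmetric ($\Psi(x,y)=\Psi(y,x)$), nonnegative and bounded. For $0\le a<T$, an admissible triple on $[a,T]$ for the controlled pressure-less Euler system is $(\rho,u,f_H)$ with $\rho\in C^1([a,T]\times\mathbb R^D;[0,\infty))$, $u\in C^1([a,T]\times\mathbb R^D;\mathbb R^D)$, $f_H\in C([a,T]\times\mathbb R^D;\mathbb R^D)$, such that there is a compact set $K\subset\mathbb R^D$ with $\operatorname{supp}\rho(t,\cdot)\subset K$ for all $t$, and which satisfies classically $\partial_t\rho+\nabla_x\cdot(\rho u)=0$, $\partial_t(\rho u)+\nabla_x\cdot(\rho u\otimes u)=Q_1+\rho f_H$,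 where $Q_1(t,x)=\int_{\mathbb R^D}\Psi(x,y)\rho(t,x)\rho(t,y)\big(u(t,y)-u(t,x)\big)dy$. Its cost on $[a,T]$ is $J^{[a,T]}_{H_1}=\int_a^T\int_{\mathbb R^D}\rho|u-\bar v|^2+\lambda\rho|f_H|^2\,dx\,dt$. An admissible triple on $[0,T]$ is optimal if for every $a\in[0,T)$ its restriction to $[a,T]$ minimizes $J^{[a,T]}_{H_1}$ among all admissible triples on $[a,T]$ with the same values of $(\rho,u)$ at time $a$. *)

(* Defs.v *)
From HB Require Import structures.
From mathcomp Require Import all_boot all_order all_algebra.
From mathcomp Require Import all_classical all_reals all_analysis.
Set Implicit Arguments. Unset Strict Implicit. Unset Printing Implicit Defensive.
Import Order.TTheory GRing.Theory Num.Theory.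
Import numFieldNormedType.Exports.
Local Open Scope classical_set_scope.
Local Open Scope ring_scope.

Section PLE.
Variable R : realType.

Definition sqnorm (D : nat) (v : 'rV[R]_D) : R := \sum_(j < D) (v ord0 j) ^+ 2.

Definition cons_rv (n : nat) (s : R) (y : 'rV[R]_n) : 'rV[R]_n.+1 :=
  \row_(j < n.+1) (if unlift ord0 j is Some k then y ord0 k else s).

(* Lebesgue integral over R^D, as the iterated Lebesgue integral over R
   (for the continuous compactly supported integrands used below this is
   the Lebesgue integral on R^D, by Fubini). *)
Fixpoint intRD (n : nat) : ('rV[R]_n -> R) -> R :=
  match n return ('rV[R]_n -> R) -> R with
  | 0 => fun f => f 0
  | n'.+1 => fun f =>
      Rintegral lebesgue_measure setT (fun s => intRD (fun y => f (cons_rv s y)))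
  end.

(* time partial derivative of g at (t,x) equals d, relative to [a,T]
   (one-sided at the endpoints) *)
Definition has_dt (D : nat) (a T : R) (g : R -> 'rV[R]_D -> R) (t : R)
  (x : 'rV[R]_D) (d : R) : Prop :=
  (fun h : R => h^-1 * (g (t + h) x - g t x))
    @ within [set h : R | a <= t + h <= T] (dnbhs (0 : R)) --> d.

Definition has_dx (D : nat) (g : R -> 'rV[R]_D -> R) (t : R)
  (x : 'rV[R]_D) (i : 'I_D) (d : R) : Prop :=
  (fun h : R => h^-1 * (g t (x + h *: delta_mx ord0 i) - g t x))
    @ dnbhs (0 : R) --> d.

Definition slab (D : nat) (a T : R) : set (R * 'rV[R]_D) :=
  [set p | a <= p.1 <= T].

Definition cont_on (D : nat) (V : topologicalType) (a T : R)
  (g : R -> 'rV[R]_D -> V) : Prop :=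
  {within @slab D a T, continuous (fun p : R * 'rV[R]_D => g p.1 p.2)}.

Definition C1_on (D : nat) (a T : R) (g : R -> 'rV[R]_D -> R) : Prop :=
  exists (gt : R -> 'rV[R]_D -> R) (gx : 'I_D -> R -> 'rV[R]_D -> R),
    [/\ cont_on a T g, cont_on a T gt, (forall i, cont_on a T (gx i)),
        (forall t x, a <= t <= T -> has_dt a T g t x (gt t x)) &
        (forall t x i, a <= t <= T -> has_dx g t x i (gx i t x))].

Definition Q1 (D : nat) (Psi : 'rV[R]_D -> 'rV[R]_D -> R)
  (rho : R -> 'rV[R]_D -> R) (u : R -> 'rV[R]_D -> 'rV[R]_D)
  (t : R) (x : 'rV[R]_D) (j : 'I_D) : R :=
  intRD (fun y => Psi x y * rho t x * rho t y * (u t y ord0 j - u t x ord0 j)).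

Definition admissible (D : nat) (Psi : 'rV[R]_D -> 'rV[R]_D -> R) (a T : R)
  (rho : R -> 'rV[R]_D -> R) (u fH : R -> 'rV[R]_D -> 'rV[R]_D) : Prop :=
  [/\ (forall t x, a <= t <= T -> 0 <= rho t x),
      C1_on a T rho,
      (forall j, C1_on a T (fun t x => u t x ord0 j)) &
      cont_on a T fH] /\
  [/\ (exists K : set 'rV[R]_D, compact K /\
         forall t, a <= t <= T -> closure [set x | rho t x != 0] `<=` K),
      (forall t x, a <= t <= T ->
         exists (dt : R) (dx : 'I_D -> R),
           [/\ has_dt a T rho t x dt,
               (forall i, has_dx (fun s y => rho s y * u s y ord0 i) t x i (dx i)) &
               dt + \sum_(i < D) dx i = 0]) &
      (forall t x j, a <= t <= T ->
         exists (dt : R) (dx : 'I_D -> R),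
           [/\ has_dt a T (fun s y => rho s y * u s y ord0 j) t x dt,
               (forall i, has_dx (fun s y => rho s y * u s y ord0 i * u s y ord0 j)
                                 t x i (dx i)) &
               dt + \sum_(i < D) dx i = Q1 Psi rho u t x j + rho t x * fH t x ord0 j])].

Definition cost (D : nat) (lam : R) (vbar : 'rV[R]_D) (a T : R)
  (rho : R -> 'rV[R]_D -> R) (u fH : R -> 'rV[R]_D -> 'rV[R]_D) : R :=
  Rintegral lebesgue_measure `[a, T]
    (fun t => intRD (fun x => rho t x * sqnorm (u t x - vbar)
                              + lam * rho t x * sqnorm (fH t x))).

Definition optimal (D : nat) (Psi : 'rV[R]_D -> 'rV[R]_D -> R) (lam : R)
  (vbar : 'rV[R]_D) (T : R)
  (rho : R -> 'rV[R]_D -> R) (u fH : R -> 'rV[R]_D -> 'rV[R]_D) : Prop :=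
  admissible Psi 0 T rho u fH /\
  forall a, 0 <= a < T ->
    forall (rho' : R -> 'rV[R]_D -> R) (u' fH' : R -> 'rV[R]_D -> 'rV[R]_D),
      admissible Psi a T rho' u' fH' ->
      (forall x, rho' a x = rho a x) -> (forall x, u' a x = u a x) ->
      cost lam vbar a T rho u fH <= cost lam vbar a T rho' u' fH'.

Definition kernel_ok (D : nat) (Psi : 'rV[R]_D -> 'rV[R]_D -> R) : Prop :=
  [/\ (exists L : R, forall x y x' y',
         `|Psi x y - Psi x' y'| <= L * (`|x - x'| + `|y - y'|)),
      (forall x y, Psi x y = Psi y x),
      (forall x y, 0 <= Psi x y) &
      (exists M : R, forall x y, Psi x y <= M)].

Definition energy (D : nat) (vbar : 'rV[R]_D) (rho : R -> 'rV[R]_D -> R)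
  (u : R -> 'rV[R]_D -> 'rV[R]_D) (t : R) : R :=
  intRD (fun x => rho t x * sqnorm (u t x - vbar)).

End PLE.

(* Main.v *)
Require Import Defs.
From HB Require Import structures.
From mathcomp Require Import all_boot all_order all_algebra.
From mathcomp Require Import all_classical all_reals all_analysis.
From mathcomp Require Import ring lra.
Import Order.TTheory GRing.Theory Num.Theory.
Import numFieldNormedType.Exports.
Local Open Scope classical_set_scope.
Local Open Scope ring_scope.

(* Write w = u - vbar and h = sqrt lam.  Integrating the evolution of
   rho |w|^2 over space, the transport terms vanish and the alignment term is
   nonpositive by symmetry of Psi, so E(t) = \int rho |w|^2 satisfies
     E(t) - E(s) <= \int_s^t \int 2 rho w . f_H.
   For the feedback control the right-hand side is - 1/h times the cost, whence
   the optimal cost on [s, T] is at most h E(s), and so is \int_s^T E.  For the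
   optimal triple Young's inequality 2 w . f <= (|w|^2 + lam |f|^2) / h bounds
   the right-hand side by 1/h times the cost, so that E(t) <= 2 E(s).  These two
   bounds together force exponential decay. *)

(** The integral bound on [E] alone controls time averages only; the inequality [E(t) <= 2 E(s)]
    turns an average over a time lapse into a bound at its endpoint. Its right-hand side must not
    depend on the past of the trajectory, so the cost bound is needed from every starting time [s]:
    this is where optimality on all the tails, each with its own feedback competitor, enters. Two
    obstacles shape the analysis. The space integral is iterated, so each manipulation has to be
    justified at every one of its levels; the class of continuous functions vanishing outside a
    fixed cube is stable under slicing and partial integration, and linearity, continuity in
    parameters and Fubini are proved for it. The equations concern [rho] and [rho u], and [rho] may
    vanish; the balance is therefore obtained by combining products, with no division by [rho]. The
    energy is never differentiated: its increments come from the fundamental theorem of calculus at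
    each point of space, followed by Fubini. *)

Lemma continuous_cstf (P Q : topologicalType) (c : Q) :
  continuous (fun _ : P => c).
Proof. by move=> p; exact: cvg_cst. Qed.

Lemma continuous_idf (P : topologicalType) : continuous (fun p : P => p).
Proof. by move=> p; exact: cvg_id. Qed.

Lemma continuous_addf (R : realType) (P : topologicalType) (f g : P -> R) :
  continuous f -> continuous g -> continuous (fun p => f p + g p).
Proof. by move=> cf cg p; apply: cvgD; [exact: cf|exact: cg]. Qed.

Lemma continuous_subf (R : realType) (P : topologicalType) (f g : P -> R) :
  continuous f -> continuous g -> continuous (fun p => f p - g p).
Proof. by move=> cf cg p; apply: cvgB; [exact: cf|exact: cg]. Qed.

Lemma continuous_mulf (R : realType) (P : topologicalType) (f g : P -> R) :
  continuous f -> continuous g -> continuous (fun p => f p * g p).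
Proof. by move=> cf cg p; apply: cvgM; [exact: cf|exact: cg]. Qed.

Lemma continuous_sumf (R : realType) (P : topologicalType) (I : Type)
    (r : seq I) (f : I -> P -> R) :
  (forall i, continuous (f i)) -> continuous (fun p => \sum_(i <- r) f i p).
Proof.
move=> cf; elim: r => [|i r IH].
  under eq_fun do rewrite big_nil.
  by move=> p; exact: cvg_cst.
by under eq_fun do rewrite big_cons; exact: continuous_addf.
Qed.

Lemma continuous_composef (P Q S : topologicalType) (f : P -> Q) (g : Q -> S) :
  continuous f -> continuous g -> continuous (fun p => g (f p)).
Proof. by move=> cf cg p; apply: (@continuous_comp _ _ _ f g); [exact: cf|exact: cg]. Qed.

Lemma continuous_pairf (P Q S : topologicalType) (f : P -> Q) (g : P -> S) :
  continuous f -> continuous g -> continuous (fun p => (f p, g p)).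
Proof. by move=> cf cg p; apply: cvg_pair; [exact: cf|exact: cg]. Qed.

Lemma continuous_fst (P Q : topologicalType) : continuous (@fst P Q).
Proof. by move=> p; exact: cvg_fst. Qed.

Lemma continuous_snd (P Q : topologicalType) : continuous (@snd P Q).
Proof. by move=> p; exact: cvg_snd. Qed.

(** A neighbourhood of a row vector contains a product of neighbourhoods of its entries; there are
    finitely many, so the conditions on the entries hold simultaneously near [p]. *)
Lemma continuous_row (R : realType) (P : topologicalType) (n : nat)
    (f : P -> 'rV[R]_n) :
  (forall j, continuous (fun p => f p ord0 j)) -> continuous f.
Proof.
move=> cf p A [B Bfp BA].
have : \forall q \near p, forall j, B ord0 j (f q ord0 j).
  by apply: filter_forall => j; exact: (cf j p _ (Bfp ord0 j)).
by apply: filterS => q Bq; apply: BA => i j; rewrite ord1.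
Qed.

Lemma continuous_coord (R : realType) (n : nat) (j : 'I_n) :
  continuous (fun x : 'rV[R]_n => x ord0 j).
Proof. exact: coord_continuous. Qed.

Lemma cons_rv0 (R : realType) (n : nat) (s : R) (y : 'rV[R]_n) :
  cons_rv s y ord0 ord0 = s.
Proof. by rewrite mxE unlift_none. Qed.

Lemma cons_rv_lift (R : realType) (n : nat) (s : R) (y : 'rV[R]_n) (j : 'I_n) :
  cons_rv s y ord0 (lift ord0 j) = y ord0 j.
Proof. by rewrite mxE liftK. Qed.

Lemma continuous_cons_rv (R : realType) (P : topologicalType) (n : nat)
    (s : P -> R) (y : P -> 'rV[R]_n) :
  continuous s -> continuous y -> continuous (fun p => cons_rv (s p) (y p)).
Proof.
move=> cs cy; apply: continuous_row => j.
case: (unliftP ord0 j) => [k|] ->.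
  under eq_fun do rewrite cons_rv_lift.
  exact: continuous_composef cy (continuous_coord _ _ _).
by under eq_fun do rewrite cons_rv0.
Qed.

(** * Iterated integrals of continuous functions supported in a cube *)

Section IteratedIntegral.
Variable R : realType.
Notation mu := (@lebesgue_measure R).

Lemma integrable_itv (a b : R) (f : R -> R) :
  continuous f -> mu.-integrable `[a, b] (EFin \o f).
Proof.
move=> cf; apply: continuous_compact_integrable; first exact: segment_compact.
exact: continuous_subspaceT.
Qed.

(** The parameter space is an arbitrary topological space, where sequences need not detect
    continuity. Instead of dominated convergence, a tube argument is used: compactness of [[a, b]]
    makes [F p] uniformly close to [F p0] for [p] near [p0]. *)
Lemma Rintegral_itv_continuous (P : topologicalType) (a b : R)
    (F : P -> R -> R) :
  continuous (fun q : P * R => F q.1 q.2) ->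
  continuous (fun p => \int[mu]_(s in `[a, b]) F p s).
Proof.
move=> cF p0; apply/cvgrPdist_le => e e0.
have cFp p : continuous (F p).
  apply: (@continuous_composef _ _ _ (fun s => (p, s)) (fun q => F q.1 q.2)) cF.
  apply: continuous_pairf; first by move=> ?; exact: cvg_cst.
  by move=> ?; exact: cvg_id.
set m := fine (mu `[a, b]).
have m0 : 0 <= m by rewrite fine_ge0.
(* The length [m] is zero when [b <= a]; dividing by [m + 1] avoids a case distinction. *)
have m1 : 0 < m + 1 by rewrite ltr_wpDl.
have e'0 : 0 < e / (m + 1) by rewrite divr_gt0.
have /compact_near_coveringP := @segment_compact R a b.
move=> /(_ P (nbhs p0) (fun p s => `|F p0 s - F p s| <= e / (m + 1)) _) H.
have {}H : \forall p \near p0, `[a, b] `<=` (fun s => `|F p0 s - F p s| <= e / (m + 1)).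
  apply: H => s _.
  have cd : continuous (fun q : R * P => `|F p0 q.1 - F q.2 q.1|).
    move=> q; apply: cvg_norm; apply: continuous_subf.
      exact: continuous_composef (@continuous_fst _ _) (cFp p0).
    apply: (@continuous_composef _ _ _ (fun q : R * P => (q.2, q.1))
      (fun q => F q.1 q.2)) cF.
    by apply: continuous_pairf => ?; [exact: cvg_snd|exact: cvg_fst].
  have := cd (s, p0); rewrite /continuous_at/= subrr normr0.
  move/cvgrPdist_le => /(_ _ e'0); apply: filterS => -[s' p] /=.
  by rewrite sub0r normrN normr_id.
apply: filterS H => p Hp.
rewrite -RintegralB//; try exact: integrable_itv.
apply: (le_trans (le_normr_Rintegral _ _)) => //.
  by apply: integrable_itv; apply: continuous_subf.
apply: (@le_trans _ _ (\int[mu]_(s in `[a, b]) (e / (m + 1)))).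
  apply: le_Rintegral => //.
  - apply: (@integrable_itv a b (fun s => `|F p0 s - F p s|)) => s.
    by apply: cvg_norm; exact: continuous_subf.
  - by apply: (@integrable_itv a b (fun s => e / (m + 1))) => s; exact: cvg_cst.
rewrite Rintegral_cst// -/m -mulrA ler_piMr ?(ltW e0)//.
by rewrite ler_pdivrMl// mulr1 lerDl.
Qed.

Lemma eq_intRD (n : nat) (f g : 'rV[R]_n -> R) : f =1 g -> intRD f = intRD g.
Proof. by move=> fg; congr intRD; exact/funext. Qed.

Lemma intRD0 (n : nat) : intRD (fun _ : 'rV[R]_n => 0 : R) = 0.
Proof.
elim: n => [//|n IH] /=; under eq_Rintegral do rewrite IH.
by rewrite Rintegral_cst// mul0r.
Qed.

Lemma intRD_ge0 (n : nat) (f : 'rV[R]_n -> R) :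
  (forall x, 0 <= f x) -> 0 <= intRD f.
Proof.
elim: n f => [f f0|n IH f f0] /=; first exact: f0.
by apply: Rintegral_ge0 => s _; apply: IH => y; exact: f0.
Qed.

(** The condition is coordinatewise, so that slices along [cons_rv] inherit it with the same [M].
    The inequality is strict: nothing is said on the faces of the cube. *)
Definition box_supported {n : nat} (M : R) (f : 'rV[R]_n -> R) :=
  forall (y : 'rV[R]_n) (j : 'I_n), M < `|y ord0 j| -> f y = 0.

Lemma box_supported_cons (n : nat) (M : R) (f : 'rV[R]_n.+1 -> R) (s : R) :
  box_supported M f -> box_supported M (fun y => f (cons_rv s y)).
Proof. by move=> sf y j yj; apply: (sf _ (lift ord0 j)); rewrite cons_rv_lift. Qed.

(** Continuity gives integrability over a compact interval but not over the line; cutting the outer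
    integral down to [[- M, M]] is what makes [integrable_itv] applicable. *)
Lemma intRDS (n : nat) (M : R) (f : 'rV[R]_n.+1 -> R) :
  box_supported M f ->
  intRD f = \int[mu]_(s in `[- M, M]) intRD (fun y => f (cons_rv s y)).
Proof.
move=> sf; rewrite /= [RHS]Rintegral_mkcond; apply: eq_Rintegral => s _.
rewrite patchE; case: ifPn => //; rewrite notin_setE/= in_itv/= -ler_norml.
move=> /negP; rewrite -ltNge => Ms.
rewrite -[RHS](intRD0 n); apply: eq_intRD => y.
by apply: (sf _ ord0); rewrite cons_rv0.
Qed.

Lemma continuous_slice (P Q S : topologicalType) (f : P -> Q -> S) (p : P) :
  continuous (fun z : P * Q => f z.1 z.2) -> continuous (f p).
Proof.
apply: (@continuous_composef _ _ _ (fun s => (p, s)) (fun z => f z.1 z.2)).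
by apply: continuous_pairf => s; [exact: cvg_cst|exact: cvg_id].
Qed.

Lemma continuous_slicel (P Q S : topologicalType) (f : P -> Q -> S) (q : Q) :
  continuous (fun z : P * Q => f z.1 z.2) -> continuous (f ^~ q).
Proof.
apply: (@continuous_composef _ _ _ (fun p => (p, q)) (fun z => f z.1 z.2)).
by apply: continuous_pairf => s; [exact: cvg_id|exact: cvg_cst].
Qed.

(** The induction generalizes the parameter space: the first coordinate joins the parameters, and
    the induction hypothesis is applied over [P * R]. *)
Lemma intRD_continuous (P : topologicalType) (n : nat) (M : R)
    (f : P -> 'rV[R]_n -> R) :
  continuous (fun q : P * 'rV[R]_n => f q.1 q.2) ->
  (forall p, box_supported M (f p)) ->
  continuous (fun p => intRD (f p)).
Proof.
elim: n P f => [|n IH] P f cf sf.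
  exact: (@continuous_slicel _ _ _ f 0 cf).
under eq_fun do rewrite (@intRDS _ M)//.
apply: (@Rintegral_itv_continuous _ _ _
  (fun p s => intRD (fun y => f p (cons_rv s y)))).
apply: (IH (P * R)%type (fun q y => f q.1 (cons_rv q.2 y))); last first.
  by move=> q; exact: box_supported_cons.
apply: (@continuous_composef _ _ _
  (fun z : P * R * 'rV[R]_n => (z.1.1, cons_rv z.1.2 z.2))
  (fun q => f q.1 q.2)) cf.
have c1 := @continuous_fst (P * R)%type 'rV[R]_n.
apply: continuous_pairf.
  exact: continuous_composef c1 (@continuous_fst _ _).
apply: continuous_cons_rv; last exact: continuous_snd.
exact: continuous_composef c1 (@continuous_snd _ _).
Qed.

Lemma continuous_consr (n : nat) (s : R) (f : 'rV[R]_n.+1 -> R) :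
  continuous f -> continuous (fun y => f (cons_rv s y)).
Proof.
apply: (@continuous_composef _ _ _ (cons_rv s)).
exact: (@continuous_cons_rv _ _ _ (fun=> s) id (@continuous_cstf _ _ _) (@continuous_idf _)).
Qed.

Lemma continuous_intRD_cons (n : nat) (M : R) (f : 'rV[R]_n.+1 -> R) :
  continuous f -> box_supported M f ->
  continuous (fun s => intRD (fun y => f (cons_rv s y))).
Proof.
move=> cf sf; apply: (@intRD_continuous _ _ M (fun s y => f (cons_rv s y))).
  apply: continuous_composef cf; apply: continuous_cons_rv.
    exact: continuous_fst.
  exact: continuous_snd.
by move=> s; exact: box_supported_cons.
Qed.

Lemma intRDD (n : nat) (M : R) (f g : 'rV[R]_n -> R) :
  continuous f -> box_supported M f -> continuous g -> box_supported M g ->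
  intRD (fun x => f x + g x) = intRD f + intRD g.
Proof.
elim: n f g => [//|n IH] f g cf sf cg sg.
rewrite (@intRDS _ M); last by move=> y j yj; rewrite (sf _ j)// (sg _ j)// addr0.
rewrite (@intRDS _ M f)// (@intRDS _ M g)// -RintegralD//.
- apply: eq_Rintegral => s _; apply: IH; try exact: continuous_consr;
    exact: box_supported_cons.
- exact/integrable_itv/(@continuous_intRD_cons _ M).
- exact/integrable_itv/(@continuous_intRD_cons _ M).
Qed.

Lemma intRDZ (n : nat) (M : R) (c : R) (f : 'rV[R]_n -> R) :
  continuous f -> box_supported M f ->
  intRD (fun x => c * f x) = c * intRD f.
Proof.
elim: n f => [//|n IH] f cf sf.
rewrite (@intRDS _ M); last by move=> y j yj; rewrite (sf _ j)// mulr0.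
rewrite (@intRDS _ M f)// -RintegralZl//.
- apply: eq_Rintegral => s _; apply: IH; first exact: continuous_consr.
  exact: box_supported_cons.
- exact/integrable_itv/(@continuous_intRD_cons _ M).
Qed.

Lemma intRDB (n : nat) (M : R) (f g : 'rV[R]_n -> R) :
  continuous f -> box_supported M f -> continuous g -> box_supported M g ->
  intRD (fun x => f x - g x) = intRD f - intRD g.
Proof.
move=> cf sf cg sg; rewrite -mulN1r -(@intRDZ _ M)// -(@intRDD _ M)//.
- by apply: eq_intRD => x; rewrite mulN1r.
- by apply: continuous_mulf => //; exact: continuous_cstf.
- by move=> y j yj; rewrite (sg _ j)// mulr0.
Qed.

Lemma intRD_sum (n : nat) (M : R) (I : Type) (r : seq I)
    (f : I -> 'rV[R]_n -> R) :
  (forall i, continuous (f i)) -> (forall i, box_supported M (f i)) ->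
  intRD (fun x => \sum_(i <- r) f i x) = \sum_(i <- r) intRD (f i).
Proof.
move=> cf sf; elim: r => [|i r IH].
  by rewrite big_nil -[RHS](intRD0 n); apply: eq_intRD => x; rewrite big_nil.
rewrite big_cons -IH -(@intRDD _ M)//; first 1 last.
- exact: continuous_sumf.
- by move=> y j yj; rewrite big1// => k _; rewrite (sf _ _ j).
by apply: eq_intRD => x; rewrite big_cons.
Qed.

Lemma le_intRD (n : nat) (M : R) (f g : 'rV[R]_n -> R) :
  continuous f -> box_supported M f -> continuous g -> box_supported M g ->
  (forall x, f x <= g x) -> intRD f <= intRD g.
Proof.
move=> cf sf cg sg fg; rewrite -subr_ge0 -(@intRDB _ M)//.
by apply: intRD_ge0 => x; rewrite subr_ge0.
Qed.

End IteratedIntegral.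

Arguments box_supported {R n}.

(** * Exchange of iterated integrals *)

Section Fubini.
Variable R : realType.
Notation mu := (@lebesgue_measure R).

Lemma continuous_swap_args (P Q S : topologicalType) (f : P -> Q -> S) :
  continuous (fun z : P * Q => f z.1 z.2) ->
  continuous (fun z : Q * P => f z.2 z.1).
Proof.
apply: (@continuous_composef _ _ _ (fun z : Q * P => (z.2, z.1))).
by apply: continuous_pairf; [exact: continuous_snd|exact: continuous_fst].
Qed.

Lemma Rintegral_itv_primitive (a : R) (f : R -> R) (x : R) :
  continuous f -> a < x ->
  derivable (fun s => \int[mu]_(t in `[a, s]) f t) x 1 /\
  derive1 (fun s => \int[mu]_(t in `[a, s]) f t) x = f x.
Proof.
move=> cf ax; apply: (@continuous_FTC1_closed _ f a x (x + 1)) => //.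
- by rewrite ltrDl.
- exact: integrable_itv.
- exact: cf.
Qed.

Lemma bounded_on_rectangle (F : R -> R -> R) (a b c d : R) :
  continuous (fun z : R * R => F z.1 z.2) ->
  exists2 C, 0 <= C & forall s t, `[a, b]%classic s -> `[c, d]%classic t -> `|F s t| <= C.
Proof.
move=> cF.
have cK : compact (`[a, b] `*` `[c, d] : set (R * R)).
  by apply: compact_setX; exact: segment_compact.
have /compact_bounded[C [_ HC]] :=
  continuous_compact (@continuous_subspaceT _ _ _ _ cF) cK.
exists (`|C| + 1); first by rewrite addr_ge0.
move=> s t sab tcd; apply: (HC (`|C| + 1)).
  by rewrite (le_lt_trans (ler_norm C))// ltrDl.
by exists (s, t).
Qed.

(* Differentiating [b |-> \int_c^d \int_a^b F] under the integral sign. *)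
Lemma Rintegral_itv_swap (F : R -> R -> R) (a b c d : R) :
  continuous (fun z : R * R => F z.1 z.2) -> a <= b ->
  \int[mu]_(s in `[a, b]) \int[mu]_(t in `[c, d]) F s t =
  \int[mu]_(t in `[c, d]) \int[mu]_(s in `[a, b]) F s t.
Proof.
move=> cF; rewrite le_eqVlt => /predU1P[<-|ab].
  rewrite set_itv1 Rintegral_set1.
  under [RHS]eq_Rintegral do rewrite Rintegral_set1.
  by rewrite Rintegral_cst// mul0r.
(* Starting the primitive at [a - 1] and working up to [b + 1] makes [a] and [b] interior points,
   where two-sided derivatives exist. The contribution of [[a - 1, a]] cancels in
   [Phi b - Phi a]. *)
pose a' := a - 1.
pose H s t := \int[mu]_(r in `[a', s]) F r t.
pose Phi s := \int[mu]_(t in `[c, d]) H s t.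
have cFt t : continuous (F ^~ t) by exact: (@continuous_slicel _ _ _ F).
have cH s : continuous (H s).
  apply: (@Rintegral_itv_continuous R _ a' s (fun t r => F r t)).
  exact: continuous_swap_args.
have dH s t : a' < s -> derivable (H ^~ t) s 1 /\ derive1 (H ^~ t) s = F s t.
  by move=> a's; exact: (@Rintegral_itv_primitive a' (F ^~ t)).
have [C C0 HC] := @bounded_on_rectangle F a' (b + 1) c d cF.
have dPhi s : a' < s < b + 1 ->
    derivable Phi s 1 /\ derive1 Phi s = \int[mu]_(t in `[c, d]) F s t.
  move=> /andP[a's sb].
  have I1 : `]a', (b + 1)[%classic s by rewrite /= in_itv/= a's.
  have I2 x : `]a', (b + 1)[%classic x -> mu.-integrable `[c, d] (EFin \o H x).
    by move=> _; exact: integrable_itv.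
  have I3 x y : `]a', (b + 1)[%classic x -> `[c, d]%classic y ->
      derivable (H ^~ y) x 1.
    by rewrite /= in_itv/= => /andP[a'x _] _; have [] := dH x y a'x.
  have I4 : mu.-integrable `[c, d] (EFin \o (fun=> C)).
    by apply: integrable_itv; exact: continuous_cstf.
  have I5 x y : `]a', (b + 1)[%classic x -> `[c, d]%classic y ->
      `|partial1of2 H x y| <= C.
    rewrite /= in_itv/= => /andP[a'x xb] ycd.
    rewrite /partial1of2 (dH x y a'x).2 HC//=.
    by rewrite in_itv/= !ltW.
  have mcd : measurable (`[c, d]%classic : set R) by [].
  split.
    exact: (@derivable_under_integral R _ _ mu H `[c, d]%classic mcd s a' (b + 1)
      I1 I2 I3 (fun=> C) (fun=> C0) I4 I5).
  rewrite /Phi (@differentiation_under_integral R _ _ mu H `[c, d]%classic mcd s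
    a' (b + 1) I1 I2 I3 (fun=> C) (fun=> C0) I4 I5).
  by apply: eq_Rintegral => t _; rewrite /partial1of2 (dH s t a's).2.
have a'a : a' < a by rewrite ltrBlDr ltrDl.
have bb : b < b + 1 by rewrite ltrDl.
have cPhi s : a' < s < b + 1 -> {for s, continuous Phi}.
  by move=> /dPhi[/derivable1_diffP/differentiable_continuous].
have -> : \int[mu]_(s in `[a, b]) \int[mu]_(t in `[c, d]) F s t = Phi b - Phi a.
  rewrite {1}/Rintegral (@continuous_FTC2 _ _ Phi)//.
  - exact/continuous_subspaceT/Rintegral_itv_continuous.
  - split.
    + move=> s; rewrite in_itv/= => /andP[sa sb].
      by have [] := dPhi s _; rewrite // (lt_trans a'a sa) (lt_trans sb bb).
    + by apply: cvg_at_right_filter; apply: cPhi; rewrite a'a (lt_trans ab bb).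
    + by apply: cvg_at_left_filter; apply: cPhi; rewrite bb (lt_trans a'a ab).
  - move=> s; rewrite in_itv/= => /andP[sa sb].
    by have [] := dPhi s _; rewrite // (lt_trans a'a sa) (lt_trans sb bb).
rewrite /Phi -RintegralB//; try exact: integrable_itv.
apply: eq_Rintegral => t _; rewrite /H.
rewrite (@Rintegral_itvB _ _ _ _ a) ?bnd_simp ?ltW//; last exact: integrable_itv.
rewrite Rintegral_itv_obnd_cbnd//.
by apply: integrableS (integrable_itv _ a b _ (cFt t)) => //; exact: subset_itv_oc_cc.
Qed.

Lemma Rintegral_intRD_swap (n : nat) (M a b : R) (f : R -> 'rV[R]_n -> R) :
  a <= b -> continuous (fun z : R * 'rV[R]_n => f z.1 z.2) ->
  (forall t, box_supported M (f t)) ->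
  \int[mu]_(t in `[a, b]) intRD (f t) =
  intRD (fun y => \int[mu]_(t in `[a, b]) f t y).
Proof.
move=> ab; elim: n f => [//|n IH] f cf sf.
under eq_Rintegral do rewrite (@intRDS _ _ M)//.
rewrite Rintegral_itv_swap//; last first.
  apply: (@intRD_continuous _ (R * R)%type _ M
    (fun z y => f z.1 (cons_rv z.2 y))).
    apply: (@continuous_composef _ _ _
      (fun z : R * R * 'rV[R]_n => (z.1.1, cons_rv z.1.2 z.2)) _ _ cf).
    have c1 := @continuous_fst (R * R)%type 'rV[R]_n.
    apply: continuous_pairf.
      exact: continuous_composef c1 (@continuous_fst _ _).
    apply: continuous_cons_rv; last exact: continuous_snd.
    exact: continuous_composef c1 (@continuous_snd _ _).
  by move=> z; exact: box_supported_cons.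
rewrite (@intRDS _ _ M); last first.
  move=> y j yj; under eq_Rintegral do rewrite (sf _ _ j)//.
  by rewrite Rintegral_cst// mul0r.
apply: eq_Rintegral => s _; apply: IH; last first.
  by move=> t; exact: box_supported_cons.
apply: (@continuous_composef _ _ _
  (fun z : R * 'rV[R]_n => (z.1, cons_rv s z.2)) _ _ cf).
apply: continuous_pairf; first exact: continuous_fst.
by apply: continuous_cons_rv; [exact: continuous_cstf|exact: continuous_snd].
Qed.

(** The coordinates of [x] are carried one at a time past the whole integral in [y], by
    [Rintegral_intRD_swap]. *)
Lemma intRD_swap (m n : nat) (M : R) (f : 'rV[R]_m -> 'rV[R]_n -> R) :
  0 <= M -> continuous (fun z : 'rV[R]_m * 'rV[R]_n => f z.1 z.2) ->
  (forall x, box_supported M (f x)) -> (forall y, box_supported M (f ^~ y)) ->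
  intRD (fun x => intRD (f x)) = intRD (fun y => intRD (f ^~ y)).
Proof.
move=> M0; elim: m f => [//|m IH] f cf sf sf'.
rewrite (@intRDS _ _ M); last first.
  move=> x j xj; rewrite -(intRD0 R n); apply: eq_intRD => y.
  exact: (sf' y x j).
have cfs s : continuous (fun z : 'rV[R]_m * 'rV[R]_n => f (cons_rv s z.1) z.2).
  apply: (@continuous_composef _ _ _
    (fun z : 'rV[R]_m * 'rV[R]_n => (cons_rv s z.1, z.2)) _ _ cf).
  apply: continuous_pairf; last exact: continuous_snd.
  by apply: continuous_cons_rv; [exact: continuous_cstf|exact: continuous_fst].
under eq_Rintegral.
  move=> s _; rewrite (IH (fun x y => f (cons_rv s x) y))//; last first.
    by move=> y; exact: (box_supported_cons _ _ _ (f ^~ y) _ (sf' y)).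
  over.
rewrite (@Rintegral_intRD_swap _ M).
- by apply: eq_intRD => y; rewrite (@intRDS _ _ M).
- by rewrite ge0_cp.
- apply: (@intRD_continuous _ (R * 'rV[R]_n)%type _ M
    (fun z x => f (cons_rv z.1 x) z.2)).
    apply: (@continuous_composef _ _ _
      (fun z : R * 'rV[R]_n * 'rV[R]_m => (cons_rv z.1.1 z.2, z.1.2)) _ _ cf).
    have c1 := @continuous_fst (R * 'rV[R]_n)%type 'rV[R]_m.
    apply: continuous_pairf.
      apply: continuous_cons_rv; last exact: continuous_snd.
      exact: continuous_composef c1 (@continuous_fst _ _).
    exact: continuous_composef c1 (@continuous_snd _ _).
  by move=> z; exact: (box_supported_cons _ _ _ (f ^~ z.2) _ (sf' z.2)).
- move=> s y j yj; rewrite -(intRD0 R m); apply: eq_intRD => x.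
  exact: (sf _ y j).
Qed.

End Fubini.

(** * Difference quotients and the fundamental theorem of calculus *)

Section DifferenceQuotient.
Variables (R : realType) (F : set_system R).
Context {FF : Filter F}.
Hypothesis F0 : F `=>` (0 : R)^'.

(** Only [F] being finer than the punctured neighbourhoods of 0 is used, so that the rules apply
    both to [has_dt], whose increments are restricted to the time interval, and to [has_dx]. *)
Lemma diffquot_cvg (f : R -> R) (f0 d : R) :
  h^-1 * (f h - f0) @[h --> F] --> d -> f h @[h --> F] --> f0.
Proof.
move=> fd.
have idF : h @[h --> F] --> (0 : R).
  by move=> A A0; apply: F0; exact: nbhs_dnbhs.
have : h * (h^-1 * (f h - f0)) + f0 @[h --> F] --> 0 * d + f0.
  by apply: cvgD; [exact: cvgM|exact: cvg_cst].
rewrite mul0r add0r; apply: cvg_trans; apply: near_eq_cvg.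
have : \forall h \near F, h != 0 by apply: F0; exact: (nbhs_dnbhs_neq (0 : R)).
by apply: filterS => h h0; rewrite mulVKf// subrK.
Qed.

Lemma diffquotM (f g : R -> R) (f0 g0 df dg : R) :
  h^-1 * (f h - f0) @[h --> F] --> df -> h^-1 * (g h - g0) @[h --> F] --> dg ->
  h^-1 * (f h * g h - f0 * g0) @[h --> F] --> df * g0 + f0 * dg.
Proof.
move=> fd gd.
have -> : (fun h => h^-1 * (f h * g h - f0 * g0)) =
    (fun h => h^-1 * (f h - f0) * g0 + f h * (h^-1 * (g h - g0))).
  by apply/funext => h; ring.
apply: cvgD; apply: cvgM => //; first exact: cvg_cst.
exact: diffquot_cvg fd.
Qed.

Lemma diffquotBc (f : R -> R) (f0 d c : R) :
  h^-1 * (f h - f0) @[h --> F] --> d ->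
  h^-1 * ((f h - c) - (f0 - c)) @[h --> F] --> d.
Proof.
move=> fd; rewrite [X in X @ F --> _](_ : _ = (fun h => h^-1 * (f h - f0)))//.
by apply/funext => h; ring.
Qed.

End DifferenceQuotient.

Lemma diffquot_derive1 (R : realType) (f : R -> R) (x d : R) :
  h^-1 * (f (x + h) - f x) @[h --> (0 : R)^'] --> d ->
  derivable f x 1 /\ derive1 f x = d.
Proof.
move=> fd.
have E : (fun h : R => h^-1 *: ((f \o shift x) (h *: (1 : R)) - f x)) =
    (fun h => h^-1 * (f (x + h) - f x)).
  by apply/funext => h /=; rewrite [h *: 1]mulr1 [h + x]addrC.
have df : derivable f x 1 by rewrite /derivable E; apply/cvg_ex; exists d.
by split=> //; rewrite derive1E /derive E; exact: cvg_lim.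
Qed.

(** The derivative is required only inside the interval, because functions extended by [clamp] may
    have a corner at the endpoints. *)
Lemma Rintegral_itv_derive (R : realType) (f df : R -> R) (a b : R) :
  a <= b -> continuous df -> continuous f ->
  (forall x, a < x < b -> h^-1 * (f (x + h) - f x) @[h --> (0 : R)^'] --> df x) ->
  \int[@lebesgue_measure R]_(x in `[a, b]) df x = f b - f a.
Proof.
rewrite le_eqVlt => /predU1P[<-|ab] cdf cf fd.
  by rewrite set_itv1 Rintegral_set1 subrr.
have dfP x : x \in `]a, b[ -> derivable f x 1 /\ derive1 f x = df x.
  by rewrite in_itv/= => /fd/diffquot_derive1.
rewrite /Rintegral (@continuous_FTC2 _ df f)//.
- exact: continuous_subspaceT.
- split; first by move=> x /dfP[].
  + by apply: cvg_at_right_filter; exact: cf.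
  + by apply: cvg_at_left_filter; exact: cf.
- by move=> x /dfP[].
Qed.

(** * Partial derivatives integrate to zero *)

Lemma cons_rv_delta0 (R : realType) (n : nat) (s h : R) (y : 'rV[R]_n) :
  cons_rv s y + h *: delta_mx ord0 ord0 = cons_rv (s + h) y.
Proof.
apply/rowP => j; case: (unliftP ord0 j) => [k|] ->.
  by rewrite mxE !cons_rv_lift !mxE/= mulr0 addr0.
by rewrite mxE !cons_rv0 !mxE !eqxx mulr1.
Qed.

Lemma cons_rv_delta_lift (R : realType) (n : nat) (s h : R) (y : 'rV[R]_n)
    (i : 'I_n) :
  cons_rv s y + h *: delta_mx ord0 (lift ord0 i) =
  cons_rv s (y + h *: delta_mx ord0 i).
Proof.
apply/rowP => j; case: (unliftP ord0 j) => [k|] ->.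
  by rewrite mxE !cons_rv_lift !mxE (inj_eq lift_inj).
by rewrite mxE !cons_rv0 !mxE/= mulr0 addr0.
Qed.

(** If [i] is not the first coordinate, each slice vanishes by induction. If it is, Fubini makes
    that coordinate the innermost one, and the inner integral is a difference of two values of [k]
    outside its support. *)
Lemma intRD_partial (R : realType) (n : nat) (M : R) (i : 'I_n)
    (k dk : 'rV[R]_n -> R) :
  0 <= M -> continuous k -> box_supported M k ->
  continuous dk -> box_supported M dk ->
  (forall x, h^-1 * (k (x + h *: delta_mx ord0 i) - k x) @[h --> (0 : R)^'] -->
     dk x) ->
  intRD dk = 0.
Proof.
move=> M0; elim: n i k dk => [[]//|n IH] i k dk ck sk cdk sdk kd.
case: (unliftP ord0 i) kd => [i' ->|->] kd.
  rewrite (@intRDS _ _ M)// (@eq_Rintegral _ _ _ _ _ (fun=> 0)).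
    by rewrite Rintegral_cst// mul0r.
  move=> s _; apply: (IH i' (fun y => k (cons_rv s y))).
  - exact: continuous_consr.
  - exact: box_supported_cons.
  - exact: continuous_consr.
  - exact: box_supported_cons.
  - by move=> y; under eq_fun do rewrite -cons_rv_delta_lift; exact: kd.
(* [box_supported] says nothing at [|s| = M]; on the larger interval both boundary values of [k] are
   zero. *)
have M1 : M < M + 1 by rewrite ltrDl.
have sdk1 : box_supported (M + 1) dk.
  by move=> y j yj; apply: (sdk y j); exact: lt_trans yj.
rewrite (@intRDS _ _ (M + 1))// (@Rintegral_intRD_swap _ _ (M + 1)).
- rewrite -(intRD0 R n); apply: eq_intRD => y.
  rewrite (@Rintegral_itv_derive _ (fun s => k (cons_rv s y))).
  + have M10 : 0 <= M + 1 by rewrite addr_ge0.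
    by rewrite !(sk _ ord0) ?subrr// cons_rv0 ?normrN ger0_norm.
  + by rewrite ge0_cp ?addr_ge0.
  + apply: (@continuous_composef _ _ _ (fun s => cons_rv s y) dk) => //.
    by apply: continuous_cons_rv; [exact: continuous_idf|exact: continuous_cstf].
  + apply: (@continuous_composef _ _ _ (fun s => cons_rv s y) k) => //.
    by apply: continuous_cons_rv; [exact: continuous_idf|exact: continuous_cstf].
  + by move=> s _; under eq_fun do rewrite -cons_rv_delta0; exact: kd.
- by rewrite ge0_cp ?addr_ge0.
- apply: (@continuous_composef _ _ _ (fun z => cons_rv z.1 z.2) dk) => //.
  by apply: continuous_cons_rv; [exact: continuous_fst|exact: continuous_snd].
- by move=> s; exact: box_supported_cons.
Qed.

(** * Dissipation by the alignment term *)

Lemma kernel_continuous (R : realType) (D : nat)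
    (Psi : 'rV[R]_D -> 'rV[R]_D -> R) :
  kernel_ok Psi -> continuous (fun z : 'rV[R]_D * 'rV[R]_D => Psi z.1 z.2).
Proof.
move=> [[L HL] _ _ _] z.
pose m (w : 'rV[R]_D * 'rV[R]_D) := L * (`|z.1 - w.1| + `|z.2 - w.2|).
have cm : m @ z --> (0 : R).
  rewrite (_ : 0 = L * (`|z.1 - z.1| + `|z.2 - z.2|)); last first.
    by rewrite !subrr !normr0 addr0 mulr0.
  apply: cvgM; first exact: cvg_cst.
  apply: cvgD; apply: cvg_norm; apply: cvgB; try exact: cvg_cst.
    exact: cvg_fst.
  exact: cvg_snd.
apply/cvgrPdist_lt => e e0.
move/cvgrPdist_lt : cm => /(_ e e0); apply: filterS => w.
rewrite sub0r normrN => mw; apply: le_lt_trans (HL _ _ _ _) _.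
exact: le_lt_trans (ler_norm _) mw.
Qed.

(* Symmetrizing in [x] and [y] turns the integrand into
   [- Psi r r (v y - v x)^2 / 2]. *)
Lemma alignment_le0 (R : realType) (D : nat) (M : R)
    (Psi : 'rV[R]_D -> 'rV[R]_D -> R) (r v : 'rV[R]_D -> R) (c : R) :
  0 <= M -> kernel_ok Psi -> continuous r -> box_supported M r ->
  (forall x, 0 <= r x) -> continuous v ->
  intRD (fun x => intRD (fun y =>
    Psi x y * r x * r y * (v y - v x) * (v x - c))) <= 0.
Proof.
move=> M0 kP cr sr r0 cv; have cP := @kernel_continuous _ _ _ kP.
case: kP => _ symP P0 _.
set f := fun x y => Psi x y * r x * r y * (v y - v x) * (v x - c).
have c1 := @continuous_fst 'rV[R]_D 'rV[R]_D.
have c2 := @continuous_snd 'rV[R]_D 'rV[R]_D.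
have c1f g := @continuous_composef _ _ R _ g c1.
have c2f g := @continuous_composef _ _ R _ g c2.
have cf : continuous (fun z : 'rV[R]_D * 'rV[R]_D => f z.1 z.2).
  apply: continuous_mulf; last first.
    by apply: continuous_subf; [exact: (c1f v)|exact: continuous_cstf].
  apply: continuous_mulf; last first.
    by apply: continuous_subf; [exact: (c2f v)|exact: (c1f v)].
  apply: continuous_mulf; last exact: (c2f r).
  by apply: continuous_mulf; [exact: cP|exact: (c1f r)].
have cf' := @continuous_swap_args _ _ _ _ cf.
have sf x : box_supported M (f x).
  by move=> y j yj; rewrite /f (sr y j)// !(mulr0, mul0r).
have sf' y : box_supported M (f ^~ y).
  by move=> x j xj; rewrite /f (sr x j)// !(mulr0, mul0r).
have cI : continuous (fun x => intRD (f x)) by exact: (@intRD_continuous _ _ _ M).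
have cI' : continuous (fun y => intRD (f ^~ y)).
  exact: (@intRD_continuous _ _ _ M (fun y x => f x y)).
have sI : box_supported M (fun x => intRD (f x)).
  move=> x j xj; rewrite -(intRD0 R D); apply: eq_intRD => y.
  exact: (sf' y x j).
have sI' : box_supported M (fun y => intRD (f ^~ y)).
  move=> y j yj; rewrite -(intRD0 R D); apply: eq_intRD => x.
  exact: (sf x y j).
suff : 0 <= - (intRD (fun x => intRD (f x)) + intRD (fun x => intRD (f x))).
  by rewrite oppr_ge0 -mulr2n pmulrn_lle0.
rewrite {2}(@intRD_swap _ _ _ M)// -(@intRDD _ _ M)// -mulN1r -(@intRDZ _ _ M).
- apply: intRD_ge0 => x.
  have cfx : continuous (f x) by exact: (@continuous_slice _ _ _ f x cf).
  have cfx' : continuous (f ^~ x) by exact: (@continuous_slicel _ _ _ f x cf).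
  rewrite -(@intRDD _ _ M _ _ cfx (sf x) cfx' (sf' x)).
  rewrite -(@intRDZ _ _ M).
  + apply: intRD_ge0 => y; rewrite /f (symP y x).
    rewrite (_ : _ * _ = Psi x y * r x * r y * (v y - v x) ^+ 2); last by ring.
    by rewrite mulr_ge0 ?sqr_ge0// !mulr_ge0.
  + exact: continuous_addf.
  + by move=> y j yj; rewrite (sf _ y j)// (sf' _ y j)// addr0.
- exact: continuous_addf.
- by move=> y j yj; rewrite (sI y j)// (sI' y j)// addr0.
Qed.

(* Precomposing with [clamp a T] extends a function on the slab to all times,
   so that continuity within the slab becomes plain continuity. *)
Definition clamp {R : realType} (a T t : R) : R := Num.max a (Num.min t T).

Lemma clamp_itv (R : realType) (a T t : R) : a <= T -> a <= clamp a T t <= T.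
Proof. by move=> aT; rewrite le_max lexx ge_max aT ge_min lexx orbT. Qed.

Lemma clamp_id (R : realType) (a T t : R) : a <= t <= T -> clamp a T t = t.
Proof. by move=> /andP[at_ tT]; rewrite /clamp (min_idPl tT) (max_idPr at_). Qed.

Lemma clamp_continuous (R : realType) (a T : R) : continuous (@clamp R a T).
Proof.
move=> t; apply: (@continuous_max _ _ (fun=> a) (fun t => Num.min t T)).
  exact: cvg_cst.
by apply: (@continuous_min _ _ (fun t => t) (fun=> T)); [exact: cvg_id|exact: cvg_cst].
Qed.

(** * Continuity, derivatives and integrals on the slab *)

Section Slab.
Variables (R : realType) (D : nat) (a T : R).
Hypothesis aT : a < T.
Notation mu := (@lebesgue_measure R).

Let clampP t : a <= clamp a T t <= T. Proof. exact/clamp_itv/ltW. Qed.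

Lemma cont_on_clamp (V : topologicalType) (g : R -> 'rV[R]_D -> V) :
  cont_on a T g ->
  continuous (fun z : R * 'rV[R]_D => g (clamp a T z.1) z.2).
Proof.
move=> /subspace_continuousP cg z.
pose c (z : R * 'rV[R]_D) := (clamp a T z.1, z.2).
have cc : continuous c.
  apply: continuous_pairf; last exact: continuous_snd.
  exact: continuous_composef (@continuous_fst _ _) (@clamp_continuous _ a T).
move=> B /(cg (c z) (clampP z.1)); rewrite /= nbhs_simpl /within/= => nB.
have := cc z _ nB; rewrite /= !nbhs_simpl/=; apply: filterS => w.
by apply; exact: clampP.
Qed.

Lemma cont_on_slice (V : topologicalType) (g : R -> 'rV[R]_D -> V) (t : R) :
  cont_on a T g -> a <= t <= T -> continuous (g t).
Proof.
move=> /cont_on_clamp cg atT; rewrite -(clamp_id _ _ _ _ atT).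
exact: (@continuous_slice _ _ _ (fun t => g (clamp a T t)) t cg).
Qed.

Lemma intRD_clamp_continuous (M : R) (g : R -> 'rV[R]_D -> R) :
  cont_on a T g -> (forall t, a <= t <= T -> box_supported M (g t)) ->
  continuous (fun t => intRD (g (clamp a T t))).
Proof.
move=> cg sg; apply: (@intRD_continuous _ _ _ M (fun t => g (clamp a T t))).
  exact: cont_on_clamp.
by move=> t; exact: sg.
Qed.

Lemma eq_Rintegral_clamp (g : R -> 'rV[R]_D -> R) (s t : R) : a <= s -> t <= T ->
  \int[mu]_(r in `[s, t]) intRD (g r) =
  \int[mu]_(r in `[s, t]) intRD (g (clamp a T r)).
Proof.
move=> as_ tT; apply: eq_Rintegral => r; rewrite inE/= in_itv/= => /andP[sr rt].
by rewrite clamp_id// (le_trans as_ sr) (le_trans rt tT).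
Qed.

Lemma integrable_intRD (M : R) (g : R -> 'rV[R]_D -> R) (s t : R) :
  cont_on a T g -> (forall t, a <= t <= T -> box_supported M (g t)) ->
  a <= s -> t <= T ->
  mu.-integrable `[s, t] (EFin \o (fun r => intRD (g r))).
Proof.
move=> cg sg as_ tT.
apply: (@eq_integrable _ _ _ mu _ _ (EFin \o (fun r => intRD (g (clamp a T r))))) => //.
  move=> r; rewrite inE/= in_itv/= => /andP[sr rt].
  by rewrite clamp_id// (le_trans as_ sr) (le_trans rt tT).
exact/integrable_itv/(intRD_clamp_continuous M).
Qed.

(** Since [a < T], every time in [[a, T]] has arbitrarily small nonzero increments staying in the
    interval: negative ones at [T], positive ones elsewhere. Without this, limits along the filter
    would not be unique. *)
Lemma within_itv_proper (t : R) : a <= t <= T ->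
  ProperFilter (within [set h : R | a <= t + h <= T] (0 : R)^').
Proof.
move=> /andP[at_ tT]; apply: Build_ProperFilter_ex => A [e /= e0 eA].
have H h : h != 0 -> `|h| < e -> a <= t + h <= T -> exists x, A x.
  by move=> h0 he ht; exists h; apply: eA => //=; rewrite sub0r normrN.
move: tT; rewrite le_eqVlt => /predU1P[tT|tT].
  pose h := Num.min (e / 2) (T - a).
  have h0 : 0 < h by rewrite lt_min divr_gt0// subr_gt0.
  have he : h <= e / 2 by rewrite ge_min lexx.
  have hT : h <= T - a by rewrite ge_min lexx orbT.
  apply: (H (- h)); first by rewrite oppr_eq0 gt_eqF.
    by rewrite normrN gtr0_norm//; lra.
  by apply/andP; split; lra.
pose h := Num.min (e / 2) (T - t).
have h0 : 0 < h by rewrite lt_min divr_gt0// subr_gt0.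
have he : h <= e / 2 by rewrite ge_min lexx.
have hT : h <= T - t by rewrite ge_min lexx orbT.
apply: (H h); first by rewrite gt_eqF.
  by rewrite gtr0_norm//; lra.
by apply/andP; split; lra.
Qed.

(** The equations of motion only assert that some derivatives exist; uniqueness identifies them with
    those given by the product rule. *)
Lemma has_dt_unique (g : R -> 'rV[R]_D -> R) (t : R) (x : 'rV[R]_D) (d d' : R) :
  a <= t <= T -> has_dt a T g t x d -> has_dt a T g t x d' -> d = d'.
Proof.
move=> /within_itv_proper PF gd gd'.
exact: (@cvg_unique _ (@norm_hausdorff _ R) _ _ _ _ gd gd').
Qed.

Lemma has_dx_unique (g : R -> 'rV[R]_D -> R) (t : R) (x : 'rV[R]_D) (i : 'I_D)
    (d d' : R) :
  has_dx g t x i d -> has_dx g t x i d' -> d = d'.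
Proof. by move=> gd gd'; exact: (@cvg_unique _ (@norm_hausdorff _ R) _ _ _ _ gd gd'). Qed.

Lemma has_dtM (f g : R -> 'rV[R]_D -> R) (t : R) (x : 'rV[R]_D) (df dg : R) :
  has_dt a T f t x df -> has_dt a T g t x dg ->
  has_dt a T (fun s y => f s y * g s y) t x (df * g t x + f t x * dg).
Proof. by move=> fd gd; apply: diffquotM => //; exact: cvg_within. Qed.

Lemma has_dxM (f g : R -> 'rV[R]_D -> R) (t : R) (x : 'rV[R]_D) (i : 'I_D)
    (df dg : R) :
  has_dx f t x i df -> has_dx g t x i dg ->
  has_dx (fun s y => f s y * g s y) t x i (df * g t x + f t x * dg).
Proof. by move=> fd gd; apply: diffquotM. Qed.

Lemma has_dtBc (f : R -> 'rV[R]_D -> R) (t : R) (x : 'rV[R]_D) (d c : R) :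
  has_dt a T f t x d -> has_dt a T (fun s y => f s y - c) t x d.
Proof. exact: diffquotBc. Qed.

Lemma has_dxBc (f : R -> 'rV[R]_D -> R) (t : R) (x : 'rV[R]_D) (i : 'I_D)
    (d c : R) :
  has_dx f t x i d -> has_dx (fun s y => f s y - c) t x i d.
Proof. exact: diffquotBc. Qed.

Lemma has_dt_box_supported (M : R) (g gt : R -> 'rV[R]_D -> R) (t : R) :
  (forall t, a <= t <= T -> box_supported M (g t)) ->
  (forall x, has_dt a T g t x (gt t x)) -> a <= t <= T ->
  box_supported M (gt t).
Proof.
move=> sg dg atT x j xj; apply: (has_dt_unique g t x) => //.
apply: cvg_near_cst; near=> h.
rewrite !(sg _ _ x j)// ?subrr ?mulr0//.
by near: h; exact: withinT.
Unshelve. all: by end_near. Qed.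

(** Lying outside the closed cube is an open condition, so it persists for small increments in [x]
    and the difference quotient is eventually zero. *)
Lemma has_dx_box_supported (M : R) (i : 'I_D) (g gx : R -> 'rV[R]_D -> R)
    (t : R) :
  box_supported M (g t) -> (forall x, has_dx g t x i (gx t x)) ->
  box_supported M (gx t).
Proof.
move=> sg dg x j xj; apply: (has_dx_unique g t x i) => //.
pose e := (delta_mx ord0 i : 'rV[R]_D) ord0 j.
have cx : x ord0 j + h * e @[h --> (0 : R)^'] --> x ord0 j + 0 * e.
  apply: cvgD; first exact: cvg_cst.
  apply: cvgM; last exact: cvg_cst.
  by move=> A A0; exact: nbhs_dnbhs.
rewrite mul0r addr0 in cx.
apply: cvg_near_cst.
have : \forall h \near (0 : R)^', M < `|x ord0 j + h * e| by exact: (cvgr_norm_gt _ cx).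
apply: filterS => h hj.
by rewrite (sg x j)// (sg _ j) ?subrr ?mulr0// mxE [X in _ + X]mxE.
Qed.

(** At a time strictly between [s] and [t] small increments stay in [[a, T]]: there the relative
    derivative is two-sided and [clamp] is the identity. *)
Lemma Rintegral_has_dt (g gt : R -> 'rV[R]_D -> R) (s t : R) (x : 'rV[R]_D) :
  cont_on a T g -> cont_on a T gt ->
  (forall t x, a <= t <= T -> has_dt a T g t x (gt t x)) ->
  a <= s -> s <= t -> t <= T ->
  \int[mu]_(r in `[s, t]) gt (clamp a T r) x = g t x - g s x.
Proof.
move=> cg cgt dg as_ st tT.
rewrite (@Rintegral_itv_derive _ (fun r => g (clamp a T r) x))//.
- by rewrite !clamp_id// ?as_ ?tT ?(le_trans st tT) ?(le_trans as_ st).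
- exact: (@continuous_slicel _ _ _ (fun r => gt (clamp a T r)) x (cont_on_clamp _ _ cgt)).
- exact: (@continuous_slicel _ _ _ (fun r => g (clamp a T r)) x (cont_on_clamp _ _ cg)).
- move=> r /andP[sr rt].
  have ar : a < r by exact: le_lt_trans sr.
  have rT : r < T by exact: lt_le_trans tT.
  have arT : a <= r <= T by rewrite !ltW.
  have nr : \forall h \near (0 : R)^', a <= r + h <= T.
    pose e := Num.min (r - a) (T - r).
    have e0 : 0 < e by rewrite lt_min !subr_gt0 ar.
    have e1 : e <= r - a by rewrite ge_min lexx.
    have e2 : e <= T - r by rewrite ge_min lexx orbT.
    have : \forall h \near (0 : R)^', `|h| < e by exact: dnbhs0_lt.
    apply: filterS => h; rewrite ltr_norml => /andP[h1 h2].
    by apply/andP; split; lra.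
  rewrite (clamp_id _ _ _ r)//.
  have := dg r x arT; rewrite /has_dt => dgr.
  move=> B /dgr; rewrite /= !nbhs_simpl /within/= => nB.
  apply: filterS (filterI nr nB) => h [hr hB].
  by rewrite /= clamp_id//; exact: hB.
Qed.

End Slab.

(** * The energy balance *)

Section EnergyBalance.
Variables (R : realType) (D : nat) (Psi : 'rV[R]_D -> 'rV[R]_D -> R) (a T M : R).
Variables (rho : R -> 'rV[R]_D -> R) (u fH : R -> 'rV[R]_D -> 'rV[R]_D).
Variables (vbar : 'rV[R]_D) (rt : R -> 'rV[R]_D -> R).
Variables (rx : 'I_D -> R -> 'rV[R]_D -> R) (ut : 'I_D -> R -> 'rV[R]_D -> R).
Variable ux : 'I_D -> 'I_D -> R -> 'rV[R]_D -> R.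
Notation mu := (@lebesgue_measure R).
Hypotheses (aT : a < T) (M0 : 0 <= M) (kP : kernel_ok Psi).
Hypothesis rho0 : forall t x, a <= t <= T -> 0 <= rho t x.
Hypothesis srho : forall t, a <= t <= T -> box_supported M (rho t).
Hypotheses (crho : cont_on a T rho) (crt : cont_on a T rt).
Hypothesis crx : forall i, cont_on a T (rx i).
Hypothesis drt : forall t x, a <= t <= T -> has_dt a T rho t x (rt t x).
Hypothesis drx : forall t x i, a <= t <= T -> has_dx rho t x i (rx i t x).
Hypothesis cu : forall j, cont_on a T (fun t x => u t x ord0 j).
Hypothesis cut : forall j, cont_on a T (ut j).
Hypothesis cux : forall j i, cont_on a T (ux j i).
Hypothesis dut : forall j t x, a <= t <= T ->
  has_dt a T (fun t x => u t x ord0 j) t x (ut j t x).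
Hypothesis dux : forall j t x i, a <= t <= T ->
  has_dx (fun t x => u t x ord0 j) t x i (ux j i t x).
Hypothesis cf : cont_on a T fH.
Hypothesis continuity_eq : forall t x, a <= t <= T ->
  exists (dt : R) (dx : 'I_D -> R),
    [/\ has_dt a T rho t x dt,
        (forall i, has_dx (fun s y => rho s y * u s y ord0 i) t x i (dx i)) &
        dt + \sum_(i < D) dx i = 0].
Hypothesis momentum_eq : forall t x j, a <= t <= T ->
  exists (dt : R) (dx : 'I_D -> R),
    [/\ has_dt a T (fun s y => rho s y * u s y ord0 j) t x dt,
        (forall i, has_dx (fun s y => rho s y * u s y ord0 i * u s y ord0 j)
                          t x i (dx i)) &
        dt + \sum_(i < D) dx i = Q1 Psi rho u t x j + rho t x * fH t x ord0 j].

(** The balance is written for each velocity component [j]: [g] is its energy density, [k j i] the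
    flux of [g j] in direction [i], [q] the summands of the divergence of [rho u], and [p] twice the
    power of the control. [gt] and [dk] are the expanded derivatives of [g] and [k], from which
    continuity and support can be read off. *)
Let w j t x := u t x ord0 j - vbar ord0 j.
Let g j t x := rho t x * (w j t x * w j t x).
Let gt j t x :=
  rt t x * (w j t x * w j t x) +
  rho t x * (ut j t x * w j t x + w j t x * ut j t x).
Let q i t x := rx i t x * u t x ord0 i + rho t x * ux i i t x.
Let k j i t x := rho t x * u t x ord0 i * (w j t x * w j t x).
Let dk j i t x :=
  q i t x * (w j t x * w j t x) +
  rho t x * u t x ord0 i * (ux j i t x * w j t x + w j t x * ux j i t x).
Let p j t x := 2 * (rho t x * w j t x * fH t x ord0 j).

Let dg j t x : a <= t <= T -> has_dt a T (g j) t x (gt j t x).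
Proof.
move=> atT; apply: has_dtM; first exact: drt.
by apply: has_dtM; apply: has_dtBc; exact: dut.
Qed.

Let dq t x i : a <= t <= T ->
  has_dx (fun s y => rho s y * u s y ord0 i) t x i (q i t x).
Proof. by move=> atT; apply: has_dxM; [exact: drx|exact: dux]. Qed.

Let dkP j t x i : a <= t <= T -> has_dx (k j i) t x i (dk j i t x).
Proof.
move=> atT; apply: has_dxM; first exact: dq.
by apply: has_dxM; apply: has_dxBc; exact: dux.
Qed.

(** Subtracting [u_j] times the continuity equation from the momentum equation leaves [rho (d_t u_j
    + u . grad u_j) = Q1 + rho f_j]. After multiplication by [w_j], adding [w_j ^ 2 / 2] times the
    continuity equation puts the left-hand side in divergence form. As [vbar] is constant, [w_j] and
    [u_j] have the same derivatives. *)
Let balance j t x : a <= t <= T ->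
  w j t x * Q1 Psi rho u t x j =
  2^-1 * (gt j t x - p j t x + \sum_(i < D) dk j i t x).
Proof.
move=> atT.
have [r' [qx [r'E qxE]]] := continuity_eq t x atT.
rewrite (has_dt_unique _ _ _ _ aT _ _ _ _ _ atT r'E (drt t x atT)).
have -> : \sum_(i < D) qx i = \sum_(i < D) q i t x.
  by apply: eq_bigr => i _; exact: has_dx_unique (qxE i) (dq t x i atT).
move=> /eqP; rewrite addrC addr_eq0 => /eqP qE.
have [m' [mx [m'E mxE_]]] := momentum_eq t x j atT.
rewrite (has_dt_unique _ _ _ _ aT _ _ _ _ _ atT m'E
  (has_dtM _ _ _ _ _ _ _ _ _ _ (drt t x atT) (dut j t x atT))).
have -> : \sum_(i < D) mx i =
    (\sum_(i < D) q i t x) * u t x ord0 j +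
    \sum_(i < D) rho t x * u t x ord0 i * ux j i t x.
  rewrite mulr_suml -big_split/=; apply: eq_bigr => i _.
  exact: has_dx_unique (mxE_ i) (has_dxM _ _ _ _ _ _ _ _ _ (dq t x i atT) (dux j t x i atT)).
rewrite qE => /eqP; rewrite -subr_eq => /eqP <-.
have -> : \sum_(i < D) dk j i t x =
    (\sum_(i < D) q i t x) * (w j t x * w j t x) +
    (\sum_(i < D) rho t x * u t x ord0 i * ux j i t x) * (2 * w j t x).
  rewrite !mulr_suml -big_split/=; apply: eq_bigr => i _; rewrite /dk; ring.
by rewrite qE /gt /p; field.
Qed.

Let cw j : cont_on a T (w j).
Proof. by apply: continuous_subf; [exact: cu|exact: continuous_cstf]. Qed.

Let cg j : cont_on a T (g j).
Proof. by apply: continuous_mulf => //; apply: continuous_mulf; exact: cw. Qed.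

Let cgt j : cont_on a T (gt j).
Proof.
apply: continuous_addf; apply: continuous_mulf => //.
  by apply: continuous_mulf; exact: cw.
by apply: continuous_addf; apply: continuous_mulf; do ?[exact: cut|exact: cw].
Qed.

Let ck j i : cont_on a T (k j i).
Proof.
apply: continuous_mulf; apply: continuous_mulf; do ?[exact: cw|exact: cu].
exact: crho.
Qed.

Let cq i : cont_on a T (q i).
Proof.
by apply: continuous_addf; apply: continuous_mulf;
  do ?[exact: crx|exact: cu|exact: crho|exact: cux].
Qed.

Let cdk j i : cont_on a T (dk j i).
Proof.
apply: continuous_addf; apply: continuous_mulf.
- exact: cq.
- by apply: continuous_mulf; exact: cw.
- by apply: continuous_mulf; [exact: crho|exact: cu].
- by apply: continuous_addf; apply: continuous_mulf; do ?[exact: cux|exact: cw].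
Qed.

Let cp j : cont_on a T (p j).
Proof.
apply: continuous_mulf; first exact: continuous_cstf.
apply: continuous_mulf; first by apply: continuous_mulf; [exact: crho|exact: cw].
exact: continuous_composef cf (continuous_coord _ _ _).
Qed.

Let srt t : a <= t <= T -> box_supported M (rt t).
Proof.
move=> atT; apply: (has_dt_box_supported _ _ _ _ aT M rho) => //.
by move=> x; exact: drt.
Qed.

Let srx t i : a <= t <= T -> box_supported M (rx i t).
Proof.
move=> atT; apply: (has_dx_box_supported _ _ M i rho); first exact: srho.
by move=> x; exact: drx.
Qed.

Let sg j t : a <= t <= T -> box_supported M (g j t).
Proof. by move=> atT x l xl; rewrite /g (srho t atT x l)// mul0r. Qed.

Let sgt j t : a <= t <= T -> box_supported M (gt j t).
Proof.
by move=> atT x l xl; rewrite /gt (srho t atT x l)// (srt t atT x l)// !mul0r addr0.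
Qed.

Let sk j i t : a <= t <= T -> box_supported M (k j i t).
Proof. by move=> atT x l xl; rewrite /k (srho t atT x l)// !mul0r. Qed.

Let sdk j i t : a <= t <= T -> box_supported M (dk j i t).
Proof.
move=> atT x l xl.
by rewrite /dk /q (srho t atT x l)// (srx t i atT x l)// !(mul0r, addr0).
Qed.

Let sp j t : a <= t <= T -> box_supported M (p j t).
Proof. by move=> atT x l xl; rewrite /p (srho t atT x l)// !mul0r mulr0. Qed.

(** This is [balance] integrated over space: the alignment side is nonpositive by [alignment_le0],
    and the flux derivatives vanish by [intRD_partial]. *)
Let dissipation j t : a <= t <= T -> intRD (gt j t) <= intRD (p j t).
Proof.
move=> atT.
have sl (h : R -> 'rV[R]_D -> R) (ch : cont_on a T h) : continuous (h t).
  exact: (cont_on_slice _ _ _ _ aT).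
have cS : continuous (fun x => \sum_(i < D) dk j i t x).
  by apply: continuous_sumf => i; exact/sl/cdk.
have sS : box_supported M (fun x => \sum_(i < D) dk j i t x).
  by move=> x l xl; rewrite big1// => i _; rewrite (sdk _ _ _ _ x l).
have cgp : continuous (fun x => gt j t x - p j t x).
  by apply: continuous_subf; exact/sl.
have sgp : box_supported M (fun x => gt j t x - p j t x).
  by move=> x l xl; rewrite (sgt _ _ _ x l)// (sp _ _ _ x l)// subr0.
have : intRD (fun x => 2^-1 * (gt j t x - p j t x + \sum_(i < D) dk j i t x)) <= 0.
  have := @alignment_le0 R D M Psi (rho t) (fun x => u t x ord0 j) (vbar ord0 j)
    M0 kP (sl _ crho) (srho t atT) (fun x => rho0 t x atT) (sl _ (cu j)).
  (* The factor [w j t x] does not depend on [y]; moving it under the integral of [Q1] gives the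
     integrand of [alignment_le0]. *)
  congr (_ <= _); apply: eq_intRD => x; rewrite -balance// mulrC -/(w j t x).
  rewrite /Q1; under eq_intRD do rewrite mulrC.
  rewrite mulrC -(@intRDZ _ _ M)//.
    apply: continuous_mulf; last first.
      by apply: continuous_subf; [exact: sl (cu j)|exact: continuous_cstf].
    apply: continuous_mulf; last exact: sl crho.
    apply: continuous_mulf; last exact: continuous_cstf.
    exact: (@continuous_slice _ _ _ Psi x (@kernel_continuous _ _ _ kP)).
  by move=> y l yl; rewrite (srho t atT y l)// mulr0 mul0r.
rewrite (@intRDZ _ _ M); last 2 first.
- exact: continuous_addf.
- by move=> x l xl; rewrite (sgp x l)// (sS x l)// addr0.
rewrite pmulr_rle0 ?invr_gt0// (@intRDD _ _ M)// (@intRD_sum _ _ M); last 2 first.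
- by move=> i; exact/sl/cdk.
- by move=> i; exact: sdk.
rewrite [X in _ + X]big1 ?addr0; last first.
  move=> i _; apply: (@intRD_partial R D M i (k j i t)) => //.
  - exact/sl/ck.
  - exact: sk.
  - exact/sl/cdk.
  - exact: sdk.
  - by move=> x; exact: dkP.
rewrite (@intRDB _ _ M) ?subr_le0//.
- exact/sl/cgt.
- exact: sgt.
- exact/sl/cp.
- exact: sp.
Qed.

(** At each [x] the increment of [g] is the time integral of [gt]; Fubini puts the space integral
    inside, where [dissipation] applies at each time. *)
Let component j s t : a <= s -> s <= t -> t <= T ->
  intRD (g j t) - intRD (g j s) <= \int[mu]_(r in `[s, t]) intRD (p j r).
Proof.
move=> as_ st tT.
have asT : a <= s <= T by rewrite as_ (le_trans st tT).
have atT : a <= t <= T by rewrite tT (le_trans as_ st).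
have cgr r : a <= r <= T -> continuous (g j r).
  by move=> arT; exact: (cont_on_slice _ _ _ _ aT _ (g j)).
rewrite -(@intRDB _ _ M _ _ (cgr t atT) (sg j t atT) (cgr s asT) (sg j s asT)).
under eq_intRD do rewrite -(Rintegral_has_dt _ _ _ _ aT (g j) (gt j) s t _
  (cg j) (cgt j) (dg j) as_ st tT).
rewrite -(@Rintegral_intRD_swap _ _ M)//; last 2 first.
- exact: cont_on_clamp.
- by move=> r; apply: sgt; exact/clamp_itv/ltW.
rewrite (@eq_Rintegral_clamp _ _ a T (p j))//; apply: le_Rintegral => //.
- apply: integrable_itv; exact: (intRD_clamp_continuous _ _ _ _ aT M (gt j) (cgt j) (sgt j)).
- apply: integrable_itv; exact: (intRD_clamp_continuous _ _ _ _ aT M (p j) (cp j) (sp j)).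
- by move=> r _; apply: dissipation; exact/clamp_itv/ltW.
Qed.

Lemma energy_balance_le s t : a <= s -> s <= t -> t <= T ->
  energy vbar rho u t - energy vbar rho u s <=
  \int[mu]_(r in `[s, t]) intRD (fun x =>
     \sum_(j < D) 2 * (rho r x * (u r x - vbar) ord0 j * fH r x ord0 j)).
Proof.
move=> as_ st tT.
have E r : a <= r <= T -> energy vbar rho u r = \sum_(j < D) intRD (g j r).
  move=> arT; rewrite -(@intRD_sum _ _ M) => [|j|j]; last exact: sg; last first.
    exact: (cont_on_slice _ _ _ _ aT).
  apply: eq_intRD => x; rewrite /sqnorm mulr_sumr; apply: eq_bigr => j _.
  by rewrite !mxE expr2.
rewrite !E ?as_ ?tT ?(le_trans st tT) ?(le_trans as_ st)// -sumrB.
apply: (@le_trans _ _ (\sum_(j < D) \int[mu]_(r in `[s, t]) intRD (p j (clamp a T r)))).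
  apply: ler_sum => j _; rewrite -eq_Rintegral_clamp//; exact: component.
rewrite (@eq_Rintegral_clamp _ _ a T
  (fun r x => \sum_(j < D) 2 * (rho r x * (u r x - vbar) ord0 j * fH r x ord0 j)))//.
have cI j : continuous (fun r => intRD (p j (clamp a T r))).
  exact: (intRD_clamp_continuous _ _ _ _ aT M (p j) (cp j) (sp j)).
rewrite le_eqVlt; apply/orP; left; apply/eqP.
transitivity (\int[mu]_(r in `[s, t]) \sum_(j < D) intRD (p j (clamp a T r))).
  elim: (index_enum _) => [|j l IH].
    rewrite big_nil; under eq_Rintegral do rewrite big_nil.
    by rewrite Rintegral_cst// mul0r.
  rewrite big_cons IH -RintegralD//; last 2 first.
  - exact: integrable_itv.
  - by apply: integrable_itv; exact: continuous_sumf.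
  by apply: eq_Rintegral => r _; rewrite big_cons.
apply: eq_Rintegral => r _; rewrite -(@intRD_sum _ _ M) => [|j|j]; last 2 first.
- by apply: (cont_on_slice _ _ _ _ aT _ (p j)) => //; exact/clamp_itv/ltW.
- by apply: sp; exact/clamp_itv/ltW.
by apply: eq_intRD => x; apply: eq_bigr => j _; rewrite /p /w !mxE.
Qed.

End EnergyBalance.

Lemma compact_box (R : realType) (n : nat) (K : set 'rV[R]_n) :
  compact K -> exists2 M : R, 0 <= M & forall x j, K x -> `|x ord0 j| <= M.
Proof.
move=> /compact_bounded[C [_ HC]]; exists (`|C| + 1); first by rewrite addr_ge0.
move=> x j /(HC (`|C| + 1)) Kx; apply: le_trans (Kx _).
  by rewrite {2}/Num.norm/= mx_normrE; apply: le_trans (le_bigmax _ _ (ord0, j)).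
by rewrite (le_lt_trans (ler_norm C))// ltrDl.
Qed.

(** * Consequences of admissibility *)

Section Admissible.
Variables (R : realType) (D : nat) (Psi : 'rV[R]_D -> 'rV[R]_D -> R) (a T : R).
Variables (rho : R -> 'rV[R]_D -> R) (u fH : R -> 'rV[R]_D -> 'rV[R]_D).
Notation mu := (@lebesgue_measure R).
Hypotheses (aT : a < T) (adm : admissible Psi a T rho u fH).

Lemma admissible_box : exists2 M : R, 0 <= M &
  forall t, a <= t <= T -> box_supported M (rho t).
Proof.
case: adm => _ [[K [/compact_box[M M0 KM] suppK]] _ _]; exists M => // t atT x j xj.
apply/eqP/negPn/negP => rx0.
by move: xj; rewrite ltNge (KM x j)//; apply: (suppK t atT); exact: subset_closure.
Qed.

Lemma admissible_energy_le (vbar : 'rV[R]_D) (s t : R) :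
  kernel_ok Psi -> a <= s -> s <= t -> t <= T ->
  energy vbar rho u t - energy vbar rho u s <=
  \int[mu]_(r in `[s, t]) intRD (fun x =>
     \sum_(j < D) 2 * (rho r x * (u r x - vbar) ord0 j * fH r x ord0 j)).
Proof.
move=> kP; have [M M0 sM] := admissible_box.
case: adm => -[rho0 [rt [rx [crho crt crx drt drx]]] C1u cf] [_ ceq meq].
(* The derivatives of [u] are given separately for each component; choice collects them into
   families indexed by [j]. *)
have /choice[ut' utP] : forall j, exists p : (R -> 'rV[R]_D -> R) *
    ('I_D -> R -> 'rV[R]_D -> R),
  [/\ cont_on a T (fun t x => u t x ord0 j), cont_on a T p.1,
      (forall i, cont_on a T (p.2 i)),
      (forall t x, a <= t <= T ->
         has_dt a T (fun t x => u t x ord0 j) t x (p.1 t x)) &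
      (forall t x i, a <= t <= T ->
         has_dx (fun t x => u t x ord0 j) t x i (p.2 i t x))].
  by move=> j; have [gt [gx ?]] := C1u j; exists (gt, gx).
apply: (@energy_balance_le R D Psi a T M rho u fH vbar rt rx
  (fun j => (ut' j).1) (fun j => (ut' j).2)) => //.
all: by move=> j; have [] := utP j.
Qed.

Variables (vbar : 'rV[R]_D) (lam : R).

Definition cost_density (t : R) (x : 'rV[R]_D) : R :=
  rho t x * sqnorm (u t x - vbar) + lam * rho t x * sqnorm (fH t x).

Let cont_u j : cont_on a T (fun t x => (u t x - vbar) ord0 j).
Proof.
case: adm => -[_ _ /(_ j)[? [? [cu _ _ _ _]]] _] _.
rewrite /cont_on (_ : (fun z => _) = (fun z : R * 'rV[R]_D =>
  u z.1 z.2 ord0 j - vbar ord0 j)).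
  by apply: continuous_subf; [exact: cu|exact: continuous_cstf].
by apply/funext => z; rewrite !mxE.
Qed.

Let cont_f j : cont_on a T (fun t x => fH t x ord0 j).
Proof.
case: adm => -[_ _ _ cf] _.
exact: continuous_composef cf (continuous_coord _ _ _).
Qed.

Let cont_rho : cont_on a T rho.
Proof. by case: adm => -[_ [? [? []]]]. Qed.

Lemma cont_on_energy_density :
  cont_on a T (fun t x => rho t x * sqnorm (u t x - vbar)).
Proof.
apply: continuous_mulf; first exact: cont_rho.
by apply: continuous_sumf => j; apply: continuous_mulf; exact: cont_u.
Qed.

Lemma cont_on_cost_density : cont_on a T cost_density.
Proof.
apply: continuous_addf; first exact: cont_on_energy_density.
apply: continuous_mulf.
  by apply: continuous_mulf; [exact: continuous_cstf|exact: cont_rho].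
by apply: continuous_sumf => j; apply: continuous_mulf; exact: cont_f.
Qed.

Lemma cont_on_power : cont_on a T (fun t x =>
  \sum_(j < D) 2 * (rho t x * (u t x - vbar) ord0 j * fH t x ord0 j)).
Proof.
apply: continuous_sumf => j; apply: continuous_mulf; first exact: continuous_cstf.
apply: continuous_mulf; last exact: cont_f.
by apply: continuous_mulf; [exact: cont_rho|exact: cont_u].
Qed.

End Admissible.

(** * Exponential decay from integral bounds *)

Lemma le_Rintegral_itvr (R : realType) (f : R -> R) (s t T : R) :
  s <= t -> t <= T -> (forall x, s <= x <= T -> 0 <= f x) ->
  (@lebesgue_measure R).-integrable `[s, T] (EFin \o f) ->
  \int[@lebesgue_measure R]_(x in `[s, t]) f x <=
  \int[@lebesgue_measure R]_(x in `[s, T]) f x.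
Proof.
move=> st tT f0 intf; rewrite -subr_ge0 (@Rintegral_itvB _ _ _ _ t) ?bnd_simp//.
apply: Rintegral_ge0 => x; rewrite /= in_itv/= => /andP[tx xT].
by rewrite f0// xT (le_trans st)// ltW.
Qed.

(* Over a time lapse [2 e h] the two hypotheses give
   [(2 e h) E(t) / 2 <= \int_s^t E <= h E(s)], i.e. a decay by a factor [e]. *)
Lemma exponential_decay (R : realType) (E : R -> R) (h T : R) :
  0 < h -> (forall t, 0 <= t <= T -> 0 <= E t) ->
  (@lebesgue_measure R).-integrable `[0, T] (EFin \o E) ->
  (forall s t, 0 <= s -> s <= t -> t < T -> E t <= 2 * E s) ->
  (forall s, 0 <= s < T ->
     \int[@lebesgue_measure R]_(t in `[s, T]) E t <= h * E s) ->
  forall t, 0 <= t < T ->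
    E t <= 2 * expR 1 * expR (- (2 * expR 1 * h)^-1 * t) * E 0.
Proof.
move=> h0 E0 intE E2 intEh.
have e0 : 0 < expR 1 :> R by exact: expR_gt0.
(* A lapse [2 c h] would give decay by a factor [c], hence the rate [ln c / (2 c h)], which is
   largest at [c = e]. *)
pose L := 2 * expR 1 * h.
have L0 : 0 < L by rewrite !mulr_gt0.
have intEs s t : 0 <= s -> t <= T ->
    (@lebesgue_measure R).-integrable `[s, t] (EFin \o E).
  move=> s0 tT; apply: integrableS intE => //.
  by apply: subset_itv; rewrite bnd_simp.
have step s : 0 <= s -> s + L < T -> E (s + L) <= expR (- 1) * E s.
  move=> s0 sLT; have sL : s < s + L by rewrite ltrDl.
  have sT : s < T by exact: lt_trans sLT.
  have I1 : E (s + L) / 2 * L <= \int[@lebesgue_measure R]_(t in `[s, s + L]) E t.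
    have mL : fine (lebesgue_measure `[s, s + L]%classic) = L.
      by rewrite lebesgue_measure_itv/= lte_fin sL/= addrAC subrr add0r.
    apply: (@le_trans _ _
      (\int[@lebesgue_measure R]_(t in `[s, s + L]) (E (s + L) / 2))).
      by rewrite Rintegral_cst// mL.
    apply: le_Rintegral => //.
    - by apply: integrable_itv; exact: continuous_cstf.
    - by apply: intEs => //; exact: ltW.
    - move=> r; rewrite /= in_itv/= => /andP[sr rL].
      by rewrite ler_pdivrMr// mulrC E2// (le_trans s0 sr).
  have I2 : E (s + L) / 2 * L <= h * E s.
    apply: le_trans I1 _; apply: le_trans (intEh s _); last by rewrite s0.
    apply: le_Rintegral_itvr; do ?[exact: ltW|exact: intEs].
    by move=> r /andP[sr rT]; apply: E0; rewrite rT (le_trans s0 sr).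
  rewrite expRN ler_pdivlMl// -(ler_pM2l h0).
  by apply: le_trans I2; rewrite /L le_eqVlt; apply/orP; left; apply/eqP; field.
(* The time left over after [n] lapses is absorbed by the doubling bound, which is the base case and
   the source of the factor 2. *)
have iter (n : nat) s : n%:R * L <= s -> s < T -> E s <= 2 * expR (- n%:R) * E 0.
  elim: n s => [|n IH] s.
    by rewrite mul0r oppr0 expR0 mulr1 => s0 sT; exact: E2.
  rewrite -natr1 mulrDl mul1r => ns sT.
  have sL : n%:R * L <= s - L by rewrite lerBrDr.
  have := step (s - L); rewrite subrK => /(_ _ sT) H.
  apply: le_trans (H _) _; first by apply: le_trans sL; rewrite mulr_ge0// ltW.
  rewrite opprD expRD.
  rewrite (_ : 2 * _ * _ = expR (- 1) * (2 * expR (- n%:R) * E 0)); last by ring.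
  rewrite ler_pM2l ?expR_gt0//.
  apply: IH => //; apply: le_lt_trans sT; rewrite lerBlDr lerDl; exact: ltW.
move=> t /andP[t0 tT].
(* Rounding [t / L] down loses less than one lapse, that is, at most a factor [e]; hence the
   constant [2 e]. *)
pose n := Num.truncn (t / L).
have /andP[nt tn] : n%:R <= t / L < n.+1%:R.
  by apply: truncn_itv; rewrite divr_ge0// ltW.
apply: le_trans (iter n t _ tT) _; first by rewrite -ler_pdivlMr.
apply: ler_wpM2r; first by apply: E0; rewrite lexx (le_trans t0 (ltW tT)).
rewrite -mulrA ler_pM2l// -expRD ler_expR -/L mulNr [_^-1 * _]mulrC.
by rewrite -natr1 in tn; lra.
Qed.

Lemma sqnorm_ge0 (R : realType) (D : nat) (v : 'rV[R]_D) : 0 <= sqnorm v.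
Proof. by apply: sumr_ge0 => j _; exact: sqr_ge0. Qed.

(** * Energy against cost *)

Section Control.
Variables (R : realType) (D : nat) (Psi : 'rV[R]_D -> 'rV[R]_D -> R) (a T : R).
Variables (rho : R -> 'rV[R]_D -> R) (u fH : R -> 'rV[R]_D -> 'rV[R]_D).
Variables (vbar : 'rV[R]_D) (lam : R).
Notation mu := (@lebesgue_measure R).
Notation h := (Num.sqrt lam).
Hypotheses (aT : a < T) (lam0 : 0 < lam) (kP : kernel_ok Psi).
Hypothesis adm : admissible Psi a T rho u fH.

Let power t x := \sum_(j < D) 2 * (rho t x * (u t x - vbar) ord0 j * fH t x ord0 j).
Let density := cost_density R D rho u fH vbar lam.

Let h0 : 0 < h. Proof. by rewrite sqrtr_gt0. Qed.
Let hh : h * h = lam. Proof. by rewrite -expr2 sqr_sqrtr// ltW. Qed.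
Let rho0 t x : a <= t <= T -> 0 <= rho t x. Proof. by case: adm => -[+ _ _ _] _; exact. Qed.

Let density_ge0 t x : a <= t <= T -> 0 <= density t x.
Proof.
move=> atT; rewrite addr_ge0// mulr_ge0 ?sqnorm_ge0 ?rho0//.
by rewrite mulr_ge0 ?rho0// ltW.
Qed.

(** The difference [density - h * power] is [rho |w - h f|^2]. The weight [h] in Young's inequality
    is the one for which the square terms are exactly those of the cost. *)
Let power_le t x : a <= t <= T -> power t x <= h^-1 * density t x.
Proof.
move=> atT; rewrite ler_pdivlMl// /density /cost_density /sqnorm /power.
rewrite !mulr_sumr -big_split/=; apply: ler_sum => j _.
set v := (u t x - vbar) ord0 j; set f := fH t x ord0 j.
move: hh; move: h => s <-.
rewrite -subr_ge0 (_ : _ - _ = rho t x * (v - s * f) ^+ 2); last by ring.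
by rewrite mulr_ge0 ?sqr_ge0 ?rho0.
Qed.

Let supp : exists2 M, 0 <= M & [/\ forall t, a <= t <= T -> box_supported M (power t),
  forall t, a <= t <= T -> box_supported M (density t) &
  forall t, a <= t <= T ->
    box_supported M (fun x => rho t x * sqnorm (u t x - vbar))].
Proof.
have [M M0 sM] := admissible_box _ _ _ _ _ _ _ _ adm; exists M => //.
split=> t atT x l xl; rewrite ?/power ?/density ?/cost_density (sM t atT x l)//.
- by rewrite big1// => j _; rewrite !mul0r mulr0.
- by rewrite mulr0 !mul0r addr0.
- by rewrite mul0r.
Qed.

Lemma energy_ge0 t : a <= t <= T -> 0 <= energy vbar rho u t.
Proof. by move=> atT; apply: intRD_ge0 => x; rewrite mulr_ge0 ?rho0 ?sqnorm_ge0. Qed.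

Lemma integrable_energy s : a <= s ->
  mu.-integrable `[s, T] (EFin \o energy vbar rho u).
Proof.
have [M M0 [_ _ sE]] := supp; move=> as_.
apply: (integrable_intRD _ _ _ _ aT M) => //.
exact: cont_on_energy_density adm vbar.
Qed.

Lemma integrable_cost s : a <= s ->
  mu.-integrable `[s, T] (EFin \o (fun t => intRD (density t))).
Proof.
have [M M0 [_ sd _]] := supp; move=> as_.
apply: (integrable_intRD _ _ _ _ aT M) => //.
exact: cont_on_cost_density adm vbar lam.
Qed.

(** The balance on [[s, t]] produces the cost on [[s, t]]; nonnegativity of the density extends it
    to [[s, T]], the interval on which optimality gives a bound. Keeping [s] apart from [a] lets a
    triple admissible on [[0, T]] be used from any later time. *)
Lemma energy_le_cost s t : a <= s -> s <= t -> t <= T ->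
  energy vbar rho u t <= energy vbar rho u s + h^-1 * cost lam vbar s T rho u fH.
Proof.
move=> as_ st tT; have [M M0 [sp sd _]] := supp.
have cd := cont_on_cost_density _ _ _ _ _ _ _ _ adm vbar lam.
have cp := cont_on_power _ _ _ _ _ _ _ _ adm vbar.
rewrite -lerBlDl; apply: le_trans (admissible_energy_le _ _ _ _ _ _ _ _ aT adm _ _ _ kP as_ st tT) _.
apply: (@le_trans _ _ (h^-1 * \int[mu]_(r in `[s, t]) intRD (density r))); last first.
  rewrite ler_pM2l ?invr_gt0//; apply: le_Rintegral_itvr => //.
    move=> r /andP[sr rT]; apply: intRD_ge0 => x; apply: density_ge0.
    by rewrite rT (le_trans as_ sr).
  exact: integrable_cost.
have intd : mu.-integrable `[s, t] (EFin \o (fun r => intRD (density r))).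
  exact: (integrable_intRD _ _ _ _ aT M).
rewrite -RintegralZl//; apply: le_Rintegral => //.
- exact: (integrable_intRD _ _ _ _ aT M power).
- exact: integrableZl intd.
- move=> r; rewrite /= in_itv/= => /andP[sr rt].
  have arT : a <= r <= T by rewrite (le_trans as_ sr) (le_trans rt tT).
  have cdr : continuous (density r) by exact: (cont_on_slice _ _ _ _ aT _ density).
  rewrite -(@intRDZ _ _ M)//; last exact: sd.
  apply: (@le_intRD _ _ M).
  + exact: (cont_on_slice _ _ _ _ aT _ power).
  + exact: sp.
  + by apply: continuous_mulf => //; exact: continuous_cstf.
  + by move=> x l xl; rewrite (sd r arT x l)// mulr0.
  + by move=> x; exact: power_le.
Qed.

Lemma energy_integral_le_cost s : a <= s ->
  \int[mu]_(t in `[s, T]) energy vbar rho u t <= cost lam vbar s T rho u fH.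
Proof.
move=> as_; have [M M0 [_ sd sE]] := supp.
apply: le_Rintegral => //; do ?[exact: integrable_cost|exact: integrable_energy].
move=> t; rewrite /= in_itv/= => /andP[st tT].
have atT : a <= t <= T by rewrite tT (le_trans as_ st).
apply: (@le_intRD _ _ M).
- exact: (cont_on_slice _ _ _ _ aT _ _ _ (cont_on_energy_density _ _ _ _ _ _ _ _ adm vbar) atT).
- exact: sE.
- exact: (cont_on_slice _ _ _ _ aT _ _ _ (cont_on_cost_density _ _ _ _ _ _ _ _ adm vbar lam) atT).
- exact: sd.
- by move=> x; rewrite lerDl !mulr_ge0 ?sqnorm_ge0 ?rho0// ltW.
Qed.

(* Under the feedback the cost density is [- h] times the power of the
   control, so the energy balance bounds the whole cost. *)
Lemma feedback_cost_le :
  (forall t x, a <= t <= T -> fH t x = - h^-1 *: (u t x - vbar)) ->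
  cost lam vbar a T rho u fH <= h * energy vbar rho u a.
Proof.
move=> fb; have [M M0 [sp sd _]] := supp.
have cp := cont_on_power _ _ _ _ _ _ _ _ adm vbar.
have hn0 : h != 0 by rewrite gt_eqF.
have -> : cost lam vbar a T rho u fH =
    - h * \int[mu]_(t in `[a, T]) intRD (power t).
  rewrite -RintegralZl//; last exact: (integrable_intRD _ _ _ _ aT M power).
  apply: eq_Rintegral => t; rewrite inE/= in_itv/= => atT.
  rewrite -(@intRDZ _ _ M); last exact: sp; last first.
    exact: (cont_on_slice _ _ _ _ aT _ power).
  apply: eq_intRD => x; rewrite /sqnorm /power !mulr_sumr -big_split/=.
  apply: eq_bigr => j _; rewrite fb//; set v := u t x - vbar.
  rewrite [(_ *: v) ord0 j]mxE; move: hh hn0; move: h => s <- sn0; by field.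
have EP : energy vbar rho u T - energy vbar rho u a <=
    \int[mu]_(t in `[a, T]) intRD (power t).
  exact: (admissible_energy_le _ _ _ _ _ _ _ _ aT adm _ _ _ kP _ (ltW aT)).
(* The final energy appears with a favourable sign and is dropped. *)
have ET : 0 <= energy vbar rho u T by rewrite energy_ge0// ltW//=.
rewrite mulNr -mulrN ler_pM2l//; lra.
Qed.

End Control.

Theorem mainTheorem13 (R : realType) (lam : R) (hlam : 0 < lam) :
  exists C alpha : R, 0 < C /\ 0 < alpha /\
  forall (D : nat) (T : R) (vbar : 'rV[R]_D) (Psi : 'rV[R]_D -> 'rV[R]_D -> R)
         (rho : R -> 'rV[R]_D -> R) (u fH : R -> 'rV[R]_D -> 'rV[R]_D),
    (1 <= D)%N -> 0 < T -> kernel_ok Psi ->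
    optimal Psi lam vbar T rho u fH ->
    (forall a, 0 <= a < T ->
       exists (rho' : R -> 'rV[R]_D -> R) (u' fH' : R -> 'rV[R]_D -> 'rV[R]_D),
         [/\ admissible Psi a T rho' u' fH',
             (forall x, rho' a x = rho a x),
             (forall x, u' a x = u a x) &
             (forall t x, a <= t <= T ->
                fH' t x = - (Num.sqrt lam)^-1 *: (u' t x - vbar))]) ->
    forall t, 0 < t < T ->
      energy vbar rho u t <= C * expR (- alpha * t) * energy vbar rho u 0.
Proof.
have h0 : 0 < Num.sqrt lam by rewrite sqrtr_gt0.
have e0 : 0 < expR 1 :> R by exact: expR_gt0.
exists (2 * expR 1), (2 * expR 1 * Num.sqrt lam)^-1.
split; first by rewrite mulr_gt0.
split; first by rewrite invr_gt0 !mulr_gt0.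
move=> D T vbar Psi rho u fH _ T0 kP [adm opt] feedback t /andP[t0 tT].
(* The feedback competitor starts at time [s] from the optimal state itself, so the two initial
   energies agree. *)
have cost_le s : 0 <= s < T ->
    cost lam vbar s T rho u fH <= Num.sqrt lam * energy vbar rho u s.
  move=> sT; have [rho' [u' [fH' [adm' rho'E u'E fb]]]] := feedback s sT.
  apply: le_trans (opt s sT rho' u' fH' adm' rho'E u'E) _.
  have -> : energy vbar rho u s = energy vbar rho' u' s.
    by apply: eq_intRD => x; rewrite rho'E u'E.
  by case/andP: sT => _ sT; exact: (feedback_cost_le _ _ _ _ _ _ _ _ _ _ sT hlam kP adm').
apply: (exponential_decay _ (energy vbar rho u) _ T) => //.
- by move=> s; exact: (energy_ge0 _ _ _ _ _ _ _ _ _ adm).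
- exact: (integrable_energy _ _ _ _ _ _ _ _ vbar lam T0 adm).
(* Here 2 arises as [1 + h^-1 * h]: the initial energy plus [h^-1] times the cost bound [h E(s)]. *)
- move=> s r s0 sr rT; have sT := le_lt_trans sr rT.
  apply: le_trans (energy_le_cost _ _ _ _ _ _ _ _ vbar _ T0 hlam kP adm s r s0 sr (ltW rT)) _.
  by rewrite mulr2n mulrDl mul1r lerD2l ler_pdivrMl// cost_le// s0.
- move=> s s0T; have /andP[s0 _] := s0T.
  apply: le_trans (cost_le s s0T).
  exact: (energy_integral_le_cost _ _ _ _ _ _ _ _ _ _ T0 hlam adm).
- by rewrite ltW.
Qed.
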